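(* Let $\gamma>0$ and $N\in\mathbb{N}=\{1,2,\dots\}$. The multiplication operator $$(\mathcal{M}_Nf)(z):=\exp\left(\frac{z^2}{\gamma^2}\right)f(z),\quad f\in\mathcal{H}_{N,\gamma}(\mathbb{C}),\ z\in\mathbb{C},$$ is a unitary operator from the polyanalytic Gaussian RBF space $\mathcal{H}_{N,\gamma}(\mathbb{C})$ onto the polyanalytic Fock space $\mathcal{F}_{\alpha,N}(\mathbb{C})$ with parameter $\alpha=\frac{2}{\gamma^2}$.
   Context: A function $f:\mathbb{C}\to\mathbb{C}$ of class $\mathcal{C}^N$ is polyanalytic of order $N$ if $\frac{\partial^N}{\partial\overline{z}^N}f=0$ on $\mathbb{C}$. With $d\lambda$ the Lebesgue measure on $\mathbb{C}$: the polyanalytic Gaussian RBF space $\mathcal{H}_{N,\gamma}(\mathbb{C})$ is the space of polyanalytic functions $f$ of order $N$ on $\mathbb{C}$ with $$\|f\|^2_{\mathcal{H}_{N,\gamma}}:=\frac{2}{\gamma^2\pi}\int_{\mathbb{C}}|f(z)|^2\exp\left(\frac{(z-\overline{z})^2}{\gamma^2}\right)d\lambda(z)<\infty,$$ and the polyanalytic Fock space $\mathcal{F}_{\alpha,N}(\mathbb{C})$, $\alpha>0$, is the space of polyanalytic functions $f$ of order $N$ on $\mathbb{C}$ with $$\|f\|^2_{\mathcal{F}_{\alpha,N}}:=\frac{\alpha}{\pi}\int_{\mathbb{C}}|f(z)|^2e^{-\alpha|z|^2}d\lambda(z)<\infty,$$ both equipped with the inner products associated with these norms. *)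

(* Defs.v *)
From HB Require Import structures.
From mathcomp Require Import all_boot all_order all_algebra.
From mathcomp Require Import complex ring lra.
From mathcomp Require Import all_classical all_reals all_analysis.
From mathcomp Require Import measurable_realfun.

Set Implicit Arguments.
Unset Strict Implicit.
Unset Printing Implicit Defensive.

Import Order.TTheory GRing.Theory Num.Theory.
Import numFieldNormedType.Exports.
Local Notation Re := complex.Re.
Local Notation Im := complex.Im.
Local Open Scope classical_set_scope.
Local Open Scope ring_scope.
Local Open Scope complex_scope.

(* R[i] carries no topology or measure in the libraries: calculus and
   integration on the complex plane are done on R * R, through
   (x, y) |-> x +i* y. *)

Notation leb2 R := (@lebesgue_measure R \x @lebesgue_measure R)%E.

Section Plane.
Variable R : realType.
Implicit Types (f g : R[i] -> R[i]) (u v : (R * R)%type -> R) (z : R[i]).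

Definition plane (p : (R * R)%type) : R[i] := p.1 +i* p.2.
Definition coords z : (R * R)%type := (Re z, Im z).

Definition re_part f (p : (R * R)%type) : R := Re (f (plane p)).
Definition im_part f (p : (R * R)%type) : R := Im (f (plane p)).

Definition dx u : (R * R)%type -> R := 'D_(1, 0) u.
Definition dy u : (R * R)%type -> R := 'D_(0, 1) u.

Fixpoint classC (k : nat) u : Prop :=
  continuous u /\
  if k is k'.+1 then
    [/\ forall p, derivable u p (1, 0) /\ derivable u p (0, 1),
        classC k' (dx u) & classC k' (dy u)]
  else True.

Definition cdx f z : R[i] :=
  dx (re_part f) (coords z) +i* dx (im_part f) (coords z).
Definition cdy f z : R[i] :=
  dy (re_part f) (coords z) +i* dy (im_part f) (coords z).

(* The Wirtinger derivative with respect to the conjugate variable. *)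
Definition dbar f z : R[i] := (cdx f z + 'i * cdy f z) / 2.

Definition polyanalytic (N : nat) f : Prop :=
  [/\ classC N (re_part f), classC N (im_part f)
    & forall z, iter N dbar f z = 0].

Definition cexp z : R[i] := (expR (Re z))%:C * (cos (Im z) +i* sin (Im z)).

Definition cintegral (h : R[i] -> R[i]) : R[i] :=
  (\int[leb2 R]_p Re (h (plane p))) +i*
  (\int[leb2 R]_p Im (h (plane p))).

Lemma classC_continuous k u : classC k u -> continuous u.
Proof. by case: k => [|k] []. Qed.

Lemma derivable_lin (a : R) u v (w p : (R * R)%type) :
  derivable u p w -> derivable v p w -> derivable (fun p => a * u p + v p) p w.
Proof.
move=> du dv.
exact (@derivableD _ _ _ (a \*: u) v p w (@derivableZ _ _ _ _ a _ _ du) dv).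
Qed.

Lemma classC_lin k (a : R) u v : classC k u -> classC k v ->
  classC k (fun p => a * u p + v p).
Proof.
have cont u' v' : continuous u' -> continuous v' ->
    continuous (fun p : (R * R)%type => a * u' p + v' p).
  move=> cu cv p; apply: cvgD; last exact: cv.
  by apply: cvgM; [exact: cvg_cst|exact: cu].
elim: k u v => [|k IH] u v /=; first by move=> [? _] [? _]; split=> //; exact: cont.
move=> [cu [du ux uy]] [cv [dv vx vy]]; split; first exact: cont.
have E w : (forall p, derivable u p w) -> (forall p, derivable v p w) ->
    'D_w (fun p => a * u p + v p) = (fun p => a * 'D_w u p + 'D_w v p).
  move=> hu hv; apply/funext => p.
  have /= := @deriveD _ _ _ (a \*: u) v p w (@derivableZ _ _ _ _ a _ _ (hu p)) (hv p).
  by rewrite deriveZ.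
split.
- move=> p; exact (conj (@derivable_lin a _ _ _ _ (du p).1 (dv p).1)
                         (@derivable_lin a _ _ _ _ (du p).2 (dv p).2)).
- rewrite /dx (E _ (fun p => (du p).1) (fun p => (dv p).1)); exact: IH.
- rewrite /dy (E _ (fun p => (du p).2) (fun p => (dv p).2)); exact: IH.
Qed.

Lemma classC_cst k (a : R) : classC k (fun=> a).
Proof.
elim: k a => [|k IH] a /=; first by split=> //; exact: cst_continuous.
have D w : 'D_w (fun=> a : R) = (fun=> 0) :> ((R * R)%type -> R).
  by apply/funext => p; exact: derive_cst.
by split; [exact: cst_continuous|split; rewrite /dx /dy ?D].
Qed.


Lemma re_part_lin (a : R[i]) f g :
  re_part (fun z => a * f z + g z) =
  (fun p => Re a * re_part f p + (- Im a * im_part f p + re_part g p)).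
Proof.
apply/funext => p; rewrite /re_part /im_part.
by case: a (f _) (g _) => [? ?] [? ?] [? ?] /=; ring.
Qed.

Lemma im_part_lin (a : R[i]) f g :
  im_part (fun z => a * f z + g z) =
  (fun p => Re a * im_part f p + (Im a * re_part f p + im_part g p)).
Proof.
apply/funext => p; rewrite /re_part /im_part.
by case: a (f _) (g _) => [? ?] [? ?] [? ?] /=; ring.
Qed.

Lemma classC_clin k (a : R[i]) f g :
  classC k (re_part f) -> classC k (im_part f) ->
  classC k (re_part g) -> classC k (im_part g) ->
  classC k (re_part (fun z => a * f z + g z)) /\
  classC k (im_part (fun z => a * f z + g z)).
Proof.
move=> rf if_ rg ig; rewrite re_part_lin im_part_lin.
by split; apply: classC_lin => //; exact: classC_lin.
Qed.

Lemma derive_lin (a b : R) u1 u2 u3 (w p : (R * R)%type) :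
  derivable u1 p w -> derivable u2 p w -> derivable u3 p w ->
  'D_w (fun p => a * u1 p + (b * u2 p + u3 p)) p =
  a * 'D_w u1 p + (b * 'D_w u2 p + 'D_w u3 p).
Proof.
move=> d1 d2 d3.
have d23 : derivable (b \*: u2 + u3) p w by exact: derivable_lin.
have /= -> := @deriveD _ _ _ (a \*: u1) (b \*: u2 + u3) p w
  (@derivableZ _ _ _ _ a _ _ d1) d23.
have /= -> := @deriveD _ _ _ (b \*: u2) u3 p w (@derivableZ _ _ _ _ b _ _ d2) d3.
by rewrite !deriveZ.
Qed.

Lemma dbar_lin k (a : R[i]) f g :
  classC k.+1 (re_part f) -> classC k.+1 (im_part f) ->
  classC k.+1 (re_part g) -> classC k.+1 (im_part g) ->
  dbar (fun z => a * f z + g z) = (fun z => a * dbar f z + dbar g z).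
Proof.
move=> [_ [drf _ _]] [_ [dif _ _]] [_ [drg _ _]] [_ [dig _ _]].
apply/funext => z; rewrite /dbar /cdx /cdy re_part_lin im_part_lin /dx /dy.
have [rfx rfy] := drf (coords z); have [ifx ify] := dif (coords z).
have [rgx rgy] := drg (coords z); have [igx igy] := dig (coords z).
rewrite (@derive_lin _ _ _ _ _ _ _ rfx ifx rgx) (@derive_lin _ _ _ _ _ _ _ ifx rfx igx).
rewrite (@derive_lin _ _ _ _ _ _ _ rfy ify rgy) (@derive_lin _ _ _ _ _ _ _ ify rfy igy).
rewrite mulrA -mulrDl; congr (_ / _).
case: a => a1 a2; do 8!(move: ('D__ _ _) => ? /=).
by congr (_ +i* _) => /=; ring.
Qed.

Lemma re_part_dbar f :
  re_part (dbar f) =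
  (fun p => 2^-1 * dx (re_part f) p + (- 2^-1 * dy (im_part f) p + 0)).
Proof.
apply/funext => -[x y]; rewrite [LHS]/re_part /dbar.
have -> : (2 : R[i])^-1 = (2^-1)%:C by rewrite fmorphV rmorph_nat.
rewrite /cdx /cdy /= /coords /=.
by do 4!(move: (_ (_ f) (x, y)) => ?); ring.
Qed.

Lemma im_part_dbar f :
  im_part (dbar f) =
  (fun p => 2^-1 * dx (im_part f) p + (2^-1 * dy (re_part f) p + 0)).
Proof.
apply/funext => -[x y]; rewrite [LHS]/im_part /dbar.
have -> : (2 : R[i])^-1 = (2^-1)%:C by rewrite fmorphV rmorph_nat.
rewrite /cdx /cdy /= /coords /=.
by do 4!(move: (_ (_ f) (x, y)) => ?); ring.
Qed.

Lemma classC_dbar k f : classC k.+1 (re_part f) -> classC k.+1 (im_part f) ->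
  classC k (re_part (dbar f)) /\ classC k (im_part (dbar f)).
Proof.
move=> [_ [_ xr yr]] [_ [_ xi yi]]; rewrite re_part_dbar im_part_dbar.
by split; do 2!(apply: classC_lin => //); exact: classC_cst.
Qed.

Lemma iter_dbar_lin N (a : R[i]) f g :
  classC N (re_part f) -> classC N (im_part f) ->
  classC N (re_part g) -> classC N (im_part g) ->
  iter N (@dbar) (fun z => a * f z + g z) =
  (fun z => a * iter N (@dbar) f z + iter N (@dbar) g z).
Proof.
elim: N f g => [//|N IH] f g rf if_ rg ig.
rewrite !iterSr (dbar_lin a rf if_ rg ig).
have [? ?] := classC_dbar rf if_; have [? ?] := classC_dbar rg ig.
exact: IH.
Qed.

Lemma polyanalytic_lin N (a : R[i]) f g :
  polyanalytic N f -> polyanalytic N g ->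
  polyanalytic N (fun z => a * f z + g z).
Proof.
move=> [rf if_ f0] [rg ig g0].
have [? ?] := classC_clin a rf if_ rg ig.
by split=> // z; rewrite iter_dbar_lin // f0 g0 mulr0 addr0.
Qed.

Lemma polyanalytic0 N : polyanalytic N (fun=> 0).
Proof.
have r0 : re_part (fun=> 0) = (fun=> 0) by [].
have i0 : im_part (fun=> 0) = (fun=> 0) by [].
split; rewrite ?r0 ?i0; do ?exact: classC_cst.
move=> z; have -> : iter N (@dbar) (fun=> 0) = (fun=> 0) :> (R[i] -> R[i]).
  elim: N => //= N ->; apply/funext => t.
  rewrite /dbar /cdx /cdy /dx /dy r0 i0.
  have D w p : 'D_w ((fun=> 0) : (R * R)%type -> R) p = 0 by exact: derive_cst.
  by rewrite !D (_ : 0 +i* 0 = 0) // mulr0 addr0 mul0r.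
by [].
Qed.

Lemma open_measurable2 (U : set (R * R)) : open U -> measurable U.
Proof.
move=> oU.
pose I (a b : rat) : set R := [set` `](ratr a : R), (ratr b : R)[].
pose B (q : rat * rat * (rat * rat)) : set (R * R) :=
  I q.1.1 q.1.2 `*` I q.2.1 q.2.2.
have -> : U = \bigcup_q (if `[< B q `<=` U >] then B q else set0).
  apply/seteqP; split=> [[x y] Uxy|p [q _]]; last first.
    by case: asboolP => // BU /BU.
  have /nbhs_ballP[e /= e0 xyU] : nbhs (x, y) U by exact: open_nbhs_nbhs.
  have near t : exists ab : rat * rat, I ab.1 ab.2 t /\ I ab.1 ab.2 `<=` ball t e.
    have [a /itvP a_] := @rat_in_itvoo R (t - e) t ltac:(lra).
    have [b /itvP b_] := @rat_in_itvoo R t (t + e) ltac:(lra).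
    exists (a, b); split; rewrite /I /=; first by rewrite in_itv /= a_ b_.
    move=> t' /=; rewrite in_itv /= => /andP[at' t'b].
    by rewrite /ball /= ltr_norml; apply/andP; split;
      [have : t' < t + e by apply: lt_trans t'b _; rewrite b_
      |have : t - e < t' by apply: lt_trans at'; rewrite a_]; lra.
  have [a [ax aU]] := near x; have [b [by_ bU]] := near y.
  exists (a, b) => //; case: asboolP => [_|[] [x' y'] [/= Ix Iy]] //.
  by apply: xyU; split; [exact: aU|exact: bU].
apply: countable_bigcupT_measurable => [|q]; first exact: countableP.
by case: ifPn => // _; apply: measurableX; exact: measurable_itv.
Qed.

Lemma continuous_measurable_fun2 u : continuous u -> measurable_fun setT u.
Proof.
move=> cu.
apply: (measurability _ (RGenOpens.measurableE R)) => _ [_ [a [b ->] <-]].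
rewrite setTI; apply: open_measurable2.
by move/continuousP : cu; apply; exact: interval_open.
Qed.

End Plane.

Lemma fine_EFinM (R : realType) (c : R) (x : \bar R) :
  fine (c%:E * x)%E = c * fine x.
Proof.
case: x => [r| |] //=; rewrite mulr0;
  case: (ltgtP c 0) => [h|h|->]; rewrite ?mul0e //.
- by rewrite lt0_muley ?lte_fin.
- by rewrite gt0_muley ?lte_fin.
- by rewrite lt0_muleNy ?lte_fin.
- by rewrite gt0_muleNy ?lte_fin.
Qed.

(* Square norm and inner product with normalising constant c and weight w.
   The weight is complex-valued so that it can be written as in the definition
   of the spaces; it takes nonnegative real values in both of them, and the
   square norm is extended real-valued. *)
Section Weighted.
Variables (R : realType) (c : R) (w : R[i] -> R[i]).
Implicit Types f g : R[i] -> R[i].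

Definition wnormsq f : \bar R :=
  (c%:E * \int[leb2 R]_p (Re (`|f (plane p)| ^+ 2 * w (plane p)))%:E)%E.

Definition wdot f g : R[i] :=
  c%:C * cintegral (fun z => f z * (g z)^*%C * w z).

Lemma wdotff f : (forall z, Im (w z) = 0) -> wdot f f = (fine (wnormsq f))%:C.
Proof.
move=> w0; rewrite /wdot /wnormsq /cintegral.
under [X in _ +i* X]eq_Rintegral.
  move=> p _.
  have -> : Im (f (plane p) * (f (plane p))^*%C * w (plane p)) = 0.
    by case: (f _) (w _) (w0 (plane p)) => [a b] [x y] /= ->; ring.
  over.
under [X in X +i* _]eq_Rintegral.
  move=> p _.
  rewrite -sqr_normc.
  over.
have -> : \int[leb2 R]_(p in setT) (0 : R) = 0.
  by rewrite /Rintegral integral0.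
by rewrite -rmorphM /Rintegral fine_EFinM.
Qed.

Hypothesis w_ge0 : forall z, 0 <= Re (w z).
Hypothesis w_meas : measurable_fun setT (fun p => Re (w (plane p))).

Lemma wintegrandE f p : Re (`|f (plane p)| ^+ 2 * w (plane p)) =
  (re_part f p ^+ 2 + im_part f p ^+ 2) * Re (w (plane p)).
Proof.
rewrite sqr_normc /re_part /im_part.
by case: (f _) (w _) => [a b] [x y] /=; ring.
Qed.

Lemma wintegrand_ge0 f p : (0 <= (Re (`|f (plane p)| ^+ 2 * w (plane p)))%:E)%E.
Proof. by rewrite lee_fin wintegrandE mulr_ge0 // addr_ge0 // sqr_ge0. Qed.

Lemma wintegrand_meas N f : polyanalytic N f ->
  measurable_fun setT
    (EFin \o (fun p => Re (`|f (plane p)| ^+ 2 * w (plane p)))).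
Proof.
move=> [/classC_continuous cr /classC_continuous ci _].
apply/measurable_EFinP; under eq_fun do rewrite wintegrandE.
apply: measurable_funM => //; apply: measurable_funD;
  by apply: measurable_funX; exact: continuous_measurable_fun2.
Qed.

Lemma wspace_submod_closed N : submod_closed
  ([pred f | `[< polyanalytic N f /\ (wnormsq f < +oo)%E >]] :
    {pred R[i] -> R[i]^o}).
Proof.
split=> [|a f g].
  apply/asboolP; split; first exact: polyanalytic0.
  rewrite /wnormsq integral0_eq ?mule0 // => p _.
  by rewrite wintegrandE /re_part /im_part /= !expr0n addr0 mul0r.
move=> /asboolP[pf If] /asboolP[pg Ig]; apply/asboolP.
have ph := polyanalytic_lin a pf pg; split; first exact: ph.
have int_ge0 (h : R[i] -> R[i]) : (0 <= \int[leb2 R]_p (Re (`|h (plane p)| ^+ 2 * w (plane p)))%:E)%E.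
  by apply: integral_ge0 => p _; exact: wintegrand_ge0.
have [c0|c0] := leP c 0.
  by apply: (@le_lt_trans _ _ 0%E); rewrite ?ltry // mule_le0_ge0 // lee_fin.
have fin (h : R[i] -> R[i]) : (wnormsq h < +oo)%E ->
    (\int[leb2 R]_p (Re (`|h (plane p)| ^+ 2 * w (plane p)))%:E < +oo)%E.
  rewrite /wnormsq; move: (int_ge0 h).
  by case: (\int[_]_(_ in _) _)%E => [r _ _|_|//]; rewrite ?ltry // gt0_muley ?lte_fin.
have {}If := fin _ If; have {}Ig := fin _ Ig.
pose A := 2 * (Re a ^+ 2 + Im a ^+ 2).
have A0 : 0 <= A by rewrite mulr_ge0 // addr_ge0 // sqr_ge0.
rewrite /wnormsq lte_mul_pinfty ?lee_fin ?ltW //.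
pose F (h : R[i] -> R[i]) : R * R -> \bar R :=
  fun p => (Re (`|h (plane p)| ^+ 2 * w (plane p)))%:E.
have mF (h : R[i] -> R[i]) : polyanalytic N h -> measurable_fun setT (F h).
  exact: wintegrand_meas.
apply: (@le_lt_trans _ _ (\int[leb2 R]_p (A%:E * F f p + 2%:E * F g p))%E).
  apply: ge0_le_integral => [||||p _].
  - exact: measurableT.
  - by move=> p _; exact: wintegrand_ge0.
  - exact: (mF (fun z => a * f z + g z) ph).
  - by apply: emeasurable_funD; apply: measurable_funeM; exact: mF.
  rewrite /F !wintegrandE -!EFinM -EFinD lee_fin !mulrA -mulrDl.
  apply: ler_wpM2r => //; rewrite re_part_lin im_part_lin /A.
  move: (re_part f p) (im_part f p) (re_part g p) (im_part g p) => x y s t.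
  case: a {ph A A0} => a b /=.
  have : 0 <= (a * x - b * y - s) ^+ 2 + (a * y + b * x - t) ^+ 2.
    by rewrite addr_ge0 // sqr_ge0.
  nra.
rewrite ge0_integralD //=; last first.
- by apply: measurable_funeM; exact: mF.
- by move=> p _; rewrite mule_ge0 ?lee_fin //; exact: wintegrand_ge0.
- by apply: measurable_funeM; exact: mF.
- by move=> p _; rewrite mule_ge0 ?lee_fin //; exact: wintegrand_ge0.
rewrite !ge0_integralZl_EFin //; try (by move=> p _; exact: wintegrand_ge0);
  try exact: mF.
by rewrite lte_add_pinfty // lte_mul_pinfty ?lee_fin.
Qed.

End Weighted.

Section Spaces.
Variable R : realType.

Definition rbf_weight (gamma : R) (z : R[i]) : R[i] :=
  cexp ((z - z^*%C) ^+ 2 / gamma%:C ^+ 2).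

Definition fock_weight (alpha : R) (z : R[i]) : R[i] :=
  cexp (- (alpha%:C * `|z| ^+ 2)).

Definition rbf_normsq (gamma : R) (f : R[i] -> R[i]) : \bar R :=
  wnormsq (2 / (gamma ^+ 2 * pi)) (rbf_weight gamma) f.
Definition fock_normsq (alpha : R) (f : R[i] -> R[i]) : \bar R :=
  wnormsq (alpha / pi) (fock_weight alpha) f.

Definition rbf_pred (N : nat) (gamma : R) : {pred R[i] -> R[i]^o} :=
  [pred f | `[< polyanalytic N f /\ (rbf_normsq gamma f < +oo)%E >]].
Definition fock_pred (N : nat) (alpha : R) : {pred R[i] -> R[i]^o} :=
  [pred f | `[< polyanalytic N f /\ (fock_normsq alpha f < +oo)%E >]].

Lemma rbf_weightE gamma z :
  rbf_weight gamma z = (expR (- (4 * Im z ^+ 2 / gamma ^+ 2)))%:C.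
Proof.
rewrite /rbf_weight /cexp.
have -> : (z - z^*%C) ^+ 2 / gamma%:C ^+ 2 = (- (4 * Im z ^+ 2 / gamma ^+ 2))%:C.
  rewrite -rmorphXn -fmorphV; move: (gamma ^+ 2)^-1 => g.
  by case: z => x y; apply/eqP; rewrite eq_complex /=; apply/andP; split; apply/eqP; ring.
by rewrite /= cos0 sin0 mulr1.
Qed.

Lemma fock_weightE alpha z :
  fock_weight alpha z = (expR (- (alpha * (Re z ^+ 2 + Im z ^+ 2))))%:C.
Proof.
rewrite /fock_weight /cexp.
have -> : - (alpha%:C * `|z| ^+ 2) = (- (alpha * (Re z ^+ 2 + Im z ^+ 2)))%:C.
  rewrite sqr_normc.
  by case: z => x y; apply/eqP; rewrite eq_complex /=; apply/andP; split; apply/eqP; ring.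
by rewrite /= cos0 sin0 mulr1.
Qed.

Lemma rbf_submod_closed N gamma : submod_closed (rbf_pred N gamma).
Proof.
rewrite /rbf_pred /rbf_normsq; apply: wspace_submod_closed => [z|]; first by rewrite rbf_weightE expR_ge0.
under eq_fun do rewrite rbf_weightE.
apply: measurableT_comp => //.
apply: measurableT_comp => //; apply: measurable_funM => //.
apply: measurable_funM => //; apply: measurable_funX; exact: measurable_snd.
Qed.

Lemma fock_submod_closed N alpha : submod_closed (fock_pred N alpha).
Proof.
rewrite /fock_pred /fock_normsq; apply: wspace_submod_closed => [z|]; first by rewrite fock_weightE expR_ge0.
under eq_fun do rewrite fock_weightE.
apply: measurableT_comp => //.
apply: measurableT_comp => //; apply: measurable_funM => //.
apply: measurable_funD; apply: measurable_funX.
- exact: measurable_fst.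
- exact: measurable_snd.
Qed.

HB.instance Definition _ N gamma := GRing.isSubmodClosed.Build _ _
  (rbf_pred N gamma) (rbf_submod_closed N gamma).
HB.instance Definition _ N alpha := GRing.isSubmodClosed.Build _ _
  (fock_pred N alpha) (fock_submod_closed N alpha).

Record rbf_space (N : nat) (gamma : R) :=
  RbfSpace { rbf_fun :> R[i] -> R[i]^o ; _ : rbf_fun \in rbf_pred N gamma }.
Record fock_space (N : nat) (alpha : R) :=
  FockSpace { fock_fun :> R[i] -> R[i]^o ; _ : fock_fun \in fock_pred N alpha }.

Definition rbf_dot N gamma (f g : rbf_space N gamma) : R[i] :=
  wdot (2 / (gamma ^+ 2 * pi)) (rbf_weight gamma) f g.
Definition fock_dot N alpha (f g : fock_space N alpha) : R[i] :=
  wdot (alpha / pi) (fock_weight alpha) f g.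

Lemma rbf_dotff N gamma (f : rbf_space N gamma) :
  rbf_dot f f = (fine (rbf_normsq gamma f))%:C.
Proof. by apply: wdotff => z; rewrite rbf_weightE. Qed.

Lemma fock_dotff N alpha (f : fock_space N alpha) :
  fock_dot f f = (fine (fock_normsq alpha f))%:C.
Proof. by apply: wdotff => z; rewrite fock_weightE. Qed.

Definition mulM (gamma : R) (f : R[i] -> R[i]) (z : R[i]) : R[i] :=
  cexp (z ^+ 2 / gamma%:C ^+ 2) * f z.

End Spaces.

HB.instance Definition _ (R : realType) N (gamma : R) :=
  [isSub for @rbf_fun R N gamma].
HB.instance Definition _ (R : realType) N (gamma : R) :=
  [Choice of rbf_space N gamma by <:].
HB.instance Definition _ (R : realType) N (gamma : R) :=
  [SubChoice_isSubLmodule of rbf_space N gamma by <:].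
HB.instance Definition _ (R : realType) N (alpha : R) :=
  [isSub for @fock_fun R N alpha].
HB.instance Definition _ (R : realType) N (alpha : R) :=
  [Choice of fock_space N alpha by <:].
HB.instance Definition _ (R : realType) N (alpha : R) :=
  [SubChoice_isSubLmodule of fock_space N alpha by <:].

Definition unitary (R : realType) (U V : lmodType R[i])
    (dotU : U -> U -> R[i]) (dotV : V -> V -> R[i]) (T : {linear U -> V}) : Prop :=
  bijective T /\ (forall f g, dotV (T f) (T g) = dotU f g).

(* Main.v *)
Require Import Defs.
From HB Require Import structures.
From mathcomp Require Import all_boot all_order all_algebra.
From mathcomp Require Import complex ring.
From mathcomp Require Import all_classical all_reals all_analysis.

(** Multiplication by a nowhere vanishing entire function F preserves
    polyanalyticity of order N: since dbar F = 0, the Leibniz rule makes F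
    behave as a constant for dbar, so that dbar^N (F f) = F dbar^N f
    ([iter_dbar_holomorphicM]).  Here F (z) = exp (z^2 / gamma^2), whose inverse
    exp (- z^2 / gamma^2) is of the same kind, so multiplication by F is
    bijective on polyanalytic functions of order N.

    It remains to compare the weights, and this is a pointwise identity: with
    z = x + iy,
      |F z|^2 exp (- (2 / gamma^2) |z|^2)
        = exp ((2 (x^2 - y^2) - 2 (x^2 + y^2)) / gamma^2)
        = exp (- 4 y^2 / gamma^2) = exp ((z - conj z)^2 / gamma^2)
    ([fock_weight_gauss]).  The normalising constants also agree, so the two
    inner products, and the two square norms, are integrals of the same function
    ([fock_wdot_mulM], [fock_normsq_mulM]); in particular the integrability
    conditions defining the two spaces correspond to each other.

    Smoothness is expressed by directional derivatives of real and imaginary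
    parts in the two coordinates; the calculus below establishes the product
    rule and the chain rule for exp in these terms. *)

Import Order.TTheory GRing.Theory Num.Theory.
Import numFieldNormedType.Exports.
Local Notation Re := complex.Re.
Local Notation Im := complex.Im.
Local Open Scope classical_set_scope.
Local Open Scope ring_scope.
Local Open Scope complex_scope.

(** * Directional derivatives and C^k functions on the plane *)

Section RealCalculus.
Set Implicit Arguments.
Unset Strict Implicit.
Context {R : realType}.
Implicit Types (u v a b ux uy : (R * R)%type -> R) (p w : (R * R)%type).

(** Reduces directional derivatives to one-variable calculus. *)
Lemma is_derive_line u p w (du : R) :
  is_derive p w u du <-> is_derive (0 : R) 1 (fun t : R => u (t *: w + p)) du.
Proof.
have L : 'D_w u p = 'D_1 (fun t : R => u (t *: w + p)) 0.
  rewrite /derive; set g1 := fun t => t^-1 *: _; set g2 := fun t => t^-1 *: _.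
  suff -> : g1 = g2 by [].
  apply/funext => t; rewrite /g1 /g2 /=.
  by rewrite addr0 scale0r add0r [_%:A]mulr1.
split=> -[d e]; split.
- exact: ((derivable1P _ _ _).1 d).
- by rewrite -L.
- exact: ((derivable1P _ _ _).2 d).
- by rewrite L.
Qed.

(** A chain rule along one direction at a time, because [classC] only speaks of
    partial derivatives of u. *)
Lemma is_derive_along_comp (h : R -> R) u p w (dh du : R) :
  is_derive p w u du -> is_derive (u p) 1 h dh ->
  is_derive p w (h \o u) (dh * du).
Proof.
move=> /is_derive_line Hu Hh; apply/is_derive_line.
have Hh' : is_derive ((fun t : R => u (t *: w + p)) 0) 1 h dh.
  by rewrite scale0r add0r.
exact: (is_derive1_comp Hh' Hu).
Qed.

Lemma is_derive_fst p w : is_derive p w (fst : R * R -> R) w.1.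
Proof.
apply/is_derive_line => /=.
have := @is_deriveD _ _ _ _ _ (0 : R) 1 _ _
  (is_deriveM (is_derive_id (0 : R) 1) (is_derive_cst w.1 (0 : R) 1))
  (is_derive_cst p.1 (0 : R) 1).
by rewrite scaler0 add0r addr0 [_ *: 1]mulr1.
Qed.

Lemma is_derive_snd p w : is_derive p w (snd : R * R -> R) w.2.
Proof.
apply/is_derive_line => /=.
have := @is_deriveD _ _ _ _ _ (0 : R) 1 _ _
  (is_deriveM (is_derive_id (0 : R) 1) (is_derive_cst w.2 (0 : R) 1))
  (is_derive_cst p.2 (0 : R) 1).
by rewrite scaler0 add0r addr0 [_ *: 1]mulr1.
Qed.

Lemma is_derive_expR_cos a b p w (da db : R) :
  is_derive p w a da -> is_derive p w b db ->
  is_derive p w (fun p => expR (a p) * cos (b p))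
    (expR (a p) * cos (b p) * da - expR (a p) * sin (b p) * db).
Proof.
move=> ha hb.
have he := is_derive_along_comp ha (is_derive_expR (a p)).
have hc := is_derive_along_comp hb (is_derive_cos (b p)).
have := is_deriveM he hc => /= [[d e]]; split; first exact: d.
by rewrite [LHS]e /GRing.scale /=; ring.
Qed.

Lemma is_derive_expR_sin a b p w (da db : R) :
  is_derive p w a da -> is_derive p w b db ->
  is_derive p w (fun p => expR (a p) * sin (b p))
    (expR (a p) * sin (b p) * da + expR (a p) * cos (b p) * db).
Proof.
move=> ha hb.
have he := is_derive_along_comp ha (is_derive_expR (a p)).
have hc := is_derive_along_comp hb (is_derive_sin (b p)).
have := is_deriveM he hc => /= [[d e]]; split; first exact: d.
by rewrite [LHS]e /GRing.scale /=; ring.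
Qed.

(** With [classC_elim], the interface to [classC] used in inductions on k: it
    takes the partial derivatives in whatever closed form a differentiation rule
    yields, instead of as the values of the operators [dx] and [dy]. *)
Lemma classC_intro k u ux uy : continuous u ->
  (forall p, is_derive p (1, 0) u (ux p)) ->
  (forall p, is_derive p (0, 1) u (uy p)) ->
  classC k ux -> classC k uy -> classC k.+1 u.
Proof.
move=> cu dux duy cx cy; split; first exact: cu.
have <- : ux = dx u by apply/funext => p; apply/esym; exact: derive_val.
have <- : uy = dy u by apply/funext => p; apply/esym; exact: derive_val.
by split=> [p|//|//]; split; [case: (dux p)|case: (duy p)].
Qed.

Lemma classC_elim k u : classC k.+1 u ->
  [/\ forall p, is_derive p (1, 0) u (dx u p),
      forall p, is_derive p (0, 1) u (dy u p),
      classC k (dx u) & classC k (dy u)].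
Proof.
move=> [_ [du ux uy]].
by split; [move=> p; apply: derivableP; exact: (du p).1
          |move=> p; apply: derivableP; exact: (du p).2|exact: ux|exact: uy].
Qed.

Lemma classCS k u : classC k.+1 u -> classC k u.
Proof.
elim: k u => [|k IH] u cu.
  by split; [exact: classC_continuous cu|exact: I].
have [dux duy cux cuy] := classC_elim cu.
exact: (classC_intro (classC_continuous cu) dux duy (IH _ cux) (IH _ cuy)).
Qed.

Lemma classCD k u v : classC k u -> classC k v -> classC k (fun p => u p + v p).
Proof.
move=> cu cv; have -> : (fun p => u p + v p) = (fun p => 1 * u p + v p).
  by apply/funext => p; rewrite mul1r.
exact: classC_lin.
Qed.

Lemma classCB k u v : classC k u -> classC k v -> classC k (fun p => u p - v p).
Proof.
move=> cu cv; have -> : (fun p => u p - v p) = (fun p => -1 * v p + u p).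
  by apply/funext => p; rewrite mulN1r addrC.
exact: classC_lin.
Qed.

Lemma classCM k u v : classC k u -> classC k v -> classC k (fun p => u p * v p).
Proof.
elim: k u v => [|k IH] u v cu cv; have C : continuous (fun p => u p * v p);
  do ?by move=> p; apply: cvgM;
    [exact: (classC_continuous cu)|exact: (classC_continuous cv)].
  by split; [exact: C|exact: I].
have [cu' cv'] := (classCS cu, classCS cv).
have [dux duy cux cuy] := classC_elim cu.
have [dvx dvy cvx cvy] := classC_elim cv.
apply: (classC_intro C (fun p => is_deriveM (dux p) (dvx p))
                       (fun p => is_deriveM (duy p) (dvy p)));
  by apply: classCD; exact: IH.
Qed.

(** The two functions are treated together because the derivatives of each of
    them involve both. *)
Lemma classC_expR_cos_sin k a b : classC k a -> classC k b ->
  classC k (fun p => expR (a p) * cos (b p)) /\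
  classC k (fun p => expR (a p) * sin (b p)).
Proof.
move=> ca cb.
have C (h : R -> R) : continuous h -> continuous (fun p => expR (a p) * h (b p)).
  move=> ch p; apply: cvgM.
    by apply: continuous_comp;
      [exact: (classC_continuous ca)|exact: continuous_expR].
  by apply: continuous_comp; [exact: (classC_continuous cb)|exact: ch].
have Cc := C _ (@continuous_cos R); have Cs := C _ (@continuous_sin R).
elim: k ca cb => [|k IH] ca cb.
  by split; (split; [assumption|exact: I]).
have [iec ies] := IH (classCS ca) (classCS cb).
have [dax day cax cay] := classC_elim ca.
have [dbx dby cbx cby] := classC_elim cb.
split.
- apply: (classC_intro Cc (fun p => is_derive_expR_cos (dax p) (dbx p))
                          (fun p => is_derive_expR_cos (day p) (dby p)));
  by apply: classCB; apply: classCM.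
- apply: (classC_intro Cs (fun p => is_derive_expR_sin (dax p) (dbx p))
                          (fun p => is_derive_expR_sin (day p) (dby p)));
  by apply: classCD; apply: classCM.
Qed.

End RealCalculus.

(** * The Wirtinger derivative: Leibniz rule and complex exponentials *)

Section ComplexCalculus.
Set Implicit Arguments.
Unset Strict Implicit.
Context {R : realType}.
Implicit Types (f g F q : R[i] -> R[i]) (c z : R[i]).

Definition cclassC k f := classC k (re_part f) /\ classC k (im_part f).

Lemma cclassC_id k : cclassC k (@id R[i]).
Proof.
case: k => [|k]; split.
- by split; [move=> p; exact: cvg_fst|exact: I].
- by split; [move=> p; exact: cvg_snd|exact: I].
- apply: (classC_intro _ (fun p => is_derive_fst p (1, 0))
    (fun p => is_derive_fst p (0, 1))); do ?exact: classC_cst.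
  by move=> p; exact: cvg_fst.
- apply: (classC_intro _ (fun p => is_derive_snd p (1, 0))
    (fun p => is_derive_snd p (0, 1))); do ?exact: classC_cst.
  by move=> p; exact: cvg_snd.
Qed.

Lemma cclassC_cst k c : cclassC k (fun=> c).
Proof. by split; exact: classC_cst. Qed.

Lemma re_partM f g : re_part (fun z => f z * g z) =
  (fun p => re_part f p * re_part g p - im_part f p * im_part g p).
Proof.
apply/funext => p; rewrite /re_part /im_part.
by case: (f _) (g _) => [? ?] [? ?].
Qed.

Lemma im_partM f g : im_part (fun z => f z * g z) =
  (fun p => re_part f p * im_part g p + im_part f p * re_part g p).
Proof.
apply/funext => p; rewrite /re_part /im_part.
by case: (f _) (g _) => [? ?] [? ?].
Qed.

Lemma re_part_cexp q : re_part (fun z => cexp (q z)) =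
  (fun p => expR (re_part q p) * cos (im_part q p)).
Proof. by apply/funext => p; rewrite [LHS]/re_part /cexp /= mul0r subr0. Qed.

Lemma im_part_cexp q : im_part (fun z => cexp (q z)) =
  (fun p => expR (re_part q p) * sin (im_part q p)).
Proof. by apply/funext => p; rewrite [LHS]/im_part /cexp /= mul0r addr0. Qed.

Lemma cclassCM k f g :
  cclassC k f -> cclassC k g -> cclassC k (fun z => f z * g z).
Proof.
move=> [rf jf] [rg jg]; rewrite /cclassC re_partM im_partM.
by split; [apply: classCB|apply: classCD]; exact: classCM.
Qed.

Lemma cclassC_cexp k q : cclassC k q -> cclassC k (fun z => cexp (q z)).
Proof.
move=> [rq iq]; rewrite /cclassC re_part_cexp im_part_cexp.
exact: classC_expR_cos_sin.
Qed.

Lemma cclassC_le k m f : (k <= m)%N -> cclassC m f -> cclassC k f.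
Proof.
elim: m => [|m IH]; first by rewrite leqn0 => /eqP ->.
rewrite leq_eqVlt => /predU1P[-> //|km] [rf jf].
by apply: IH => //; split; exact: classCS.
Qed.

Lemma cclassC_dbar k f : cclassC k.+1 f -> cclassC k (dbar f).
Proof. by move=> [? ?]; exact: classC_dbar. Qed.

Lemma dbar_is_derive f z (rx ry ix iy : R) :
  is_derive (coords z) (1, 0) (re_part f) rx ->
  is_derive (coords z) (0, 1) (re_part f) ry ->
  is_derive (coords z) (1, 0) (im_part f) ix ->
  is_derive (coords z) (0, 1) (im_part f) iy ->
  dbar f z = ((rx +i* ix) + 'i * (ry +i* iy)) / 2.
Proof. by move=> [_ <-] [_ <-] [_ <-] [_ <-]. Qed.

Lemma dbarM f g : cclassC 1 f -> cclassC 1 g ->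
  dbar (fun z => f z * g z) = (fun z => f z * dbar g z + g z * dbar f z).
Proof.
move=> [/classC_elim[rfx rfy _ _] /classC_elim[ifx ify _ _]].
move=> [/classC_elim[rgx rgy _ _] /classC_elim[igx igy _ _]].
apply/funext => -[x y]; pose p := coords (x +i* y).
rewrite (dbar_is_derive (rfx p) (rfy p) (ifx p) (ify p)).
rewrite (dbar_is_derive (rgx p) (rgy p) (igx p) (igy p)).
have rM w (a b c d : R) :
    is_derive p w (re_part f) a -> is_derive p w (im_part f) b ->
    is_derive p w (re_part g) c -> is_derive p w (im_part g) d ->
    is_derive p w (re_part (fun z => f z * g z))
      ((re_part f p *: c + re_part g p *: a) -
       (im_part f p *: d + im_part g p *: b)).
  by move=> ? ? ? ?; rewrite re_partM; apply: is_deriveB.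
have iM w (a b c d : R) :
    is_derive p w (re_part f) a -> is_derive p w (im_part f) b ->
    is_derive p w (re_part g) c -> is_derive p w (im_part g) d ->
    is_derive p w (im_part (fun z => f z * g z))
      ((re_part f p *: d + im_part g p *: a) +
       (im_part f p *: c + re_part g p *: b)).
  by move=> ? ? ? ?; rewrite im_partM; apply: is_deriveD.
rewrite (dbar_is_derive
  (rM _ _ _ _ _ (rfx p) (ifx p) (rgx p) (igx p))
  (rM _ _ _ _ _ (rfy p) (ify p) (rgy p) (igy p))
  (iM _ _ _ _ _ (rfx p) (ifx p) (rgx p) (igx p))
  (iM _ _ _ _ _ (rfy p) (ify p) (rgy p) (igy p))).
(* Only the eight partial derivatives have the shape [_ (_ _) p]; with them
   abstracted, an identity between polynomials remains. *)
do 8!(move: (_ (_ _) p) => ?).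
rewrite [X in _ = X + _]mulrA [X in _ = _ + X]mulrA -mulrDl; congr (_ / _).
rewrite /re_part /im_part /GRing.scale /=.
case: (f _) (g _) => [f1 f2] [g1 g2] /=.
by congr (_ +i* _) => /=; ring.
Qed.

Lemma dbar_id z : dbar id z = 0.
Proof.
rewrite (@dbar_is_derive id z _ _ _ _ (is_derive_fst _ _) (is_derive_fst _ _)
  (is_derive_snd _ _) (is_derive_snd _ _)) /=.
rewrite (_ : _ + _ = 0) ?mul0r //.
by apply/eqP; rewrite eq_complex /=; apply/andP; split; apply/eqP; ring.
Qed.

Lemma dbar_cst c z : dbar (fun=> c) z = 0.
Proof.
have D (w p : R * R) (r : R) : is_derive p w (fun=> r) 0 by exact: is_derive_cst.
rewrite (@dbar_is_derive (fun=> c) z _ _ _ _ (D _ _ (Re c)) (D _ _ (Re c))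
  (D _ _ (Im c)) (D _ _ (Im c))).
by rewrite (_ : 0 +i* 0 = 0) // mulr0 addr0 mul0r.
Qed.

(** Since exp is holomorphic, the chain rule for dbar has a single term. *)
Lemma dbar_cexp q : cclassC 1 q ->
  dbar (fun z => cexp (q z)) = (fun z => cexp (q z) * dbar q z).
Proof.
move=> [/classC_elim[rx ry _ _] /classC_elim[ix iy _ _]].
apply/funext => -[x y]; pose p := coords (x +i* y).
rewrite (dbar_is_derive (rx p) (ry p) (ix p) (iy p)).
have rE w (a b : R) : is_derive p w (re_part q) a -> is_derive p w (im_part q) b ->
    is_derive p w (re_part (fun z => cexp (q z)))
      (expR (re_part q p) * cos (im_part q p) * a -
       expR (re_part q p) * sin (im_part q p) * b).
  by rewrite re_part_cexp; exact: is_derive_expR_cos.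
have iE w (a b : R) : is_derive p w (re_part q) a -> is_derive p w (im_part q) b ->
    is_derive p w (im_part (fun z => cexp (q z)))
      (expR (re_part q p) * sin (im_part q p) * a +
       expR (re_part q p) * cos (im_part q p) * b).
  by rewrite im_part_cexp; exact: is_derive_expR_sin.
rewrite (dbar_is_derive (rE _ _ _ (rx p) (ix p)) (rE _ _ _ (ry p) (iy p))
  (iE _ _ _ (rx p) (ix p)) (iE _ _ _ (ry p) (iy p))).
do 4!(move: (_ (_ _) p) => ?).
rewrite [RHS]mulrA; congr (_ / _).
rewrite /cexp /re_part /im_part /=.
case: (q _) => [q1 q2] /=.
by congr (_ +i* _) => /=; ring.
Qed.

Lemma iter_dbar_holomorphicM N F f : (forall k, cclassC k F) ->
  (forall z, dbar F z = 0) -> cclassC N f ->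
  iter N (@dbar R) (fun z => F z * f z) = (fun z => F z * iter N (@dbar R) f z).
Proof.
move=> cF F0; elim: N f => [//|N IH] f cf.
have cf1 : cclassC 1 f by apply: cclassC_le cf.
rewrite !iterSr -(IH (dbar f)); last exact: cclassC_dbar.
congr (iter N _ _); rewrite (dbarM (cF 1%N) cf1).
by apply/funext => z; rewrite F0 mulr0 addr0.
Qed.

Lemma polyanalytic_holomorphicM N F f : (forall k, cclassC k F) ->
  (forall z, dbar F z = 0) -> polyanalytic N f ->
  polyanalytic N (fun z => F z * f z).
Proof.
move=> cF F0 [rf jf f0].
have [rFf iFf] := cclassCM (cF N) (conj rf jf).
split=> // z; rewrite (iter_dbar_holomorphicM cF F0 (conj rf jf)).
by rewrite f0 mulr0.
Qed.

Lemma cexpD z t : cexp (z + t) = cexp z * cexp t.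
Proof.
case: z t => [x y] [s t]; rewrite /cexp /= expRD cosD sinD.
by apply/eqP; rewrite eq_complex /=; apply/andP; split; apply/eqP; ring.
Qed.

(** The parameter c covers both the multiplier, for c = 1 / gamma^2, and its
    inverse, for the opposite value of c. *)
Definition gauss c z : R[i] := cexp (z ^+ 2 * c).

Lemma gaussN c z : gauss c z * gauss (- c) z = 1.
Proof.
by rewrite /gauss -cexpD mulrN subrr /cexp /= expR0 cos0 sin0 mul1r.
Qed.

Lemma cclassC_sqr k : cclassC k (fun z => z ^+ 2).
Proof. by apply: cclassCM; exact: cclassC_id. Qed.

Lemma cclassC_gauss c k : cclassC k (gauss c).
Proof.
apply: cclassC_cexp; apply: (cclassCM (cclassC_sqr k)); exact: cclassC_cst.
Qed.

Lemma dbar_gauss c z : dbar (gauss c) z = 0.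
Proof.
have cq := cclassCM (cclassC_sqr 1) (cclassC_cst 1 c).
rewrite /gauss (dbar_cexp cq) (dbarM (cclassC_sqr 1) (cclassC_cst 1 c)).
rewrite dbar_cst (dbarM (cclassC_id 1) (cclassC_id 1)).
by rewrite !dbar_id !(mulr0, addr0).
Qed.

End ComplexCalculus.

(** * The two spaces correspond under multiplication by exp (z^2 / gamma^2) *)

Section Isometry.
Set Implicit Arguments.
Unset Strict Implicit.
Context {R : realType}.
Implicit Types (gamma : R) (N : nat) (f g : R[i] -> R[i]).

Lemma mulME gamma f :
  mulM gamma f = (fun z => gauss (gamma%:C ^+ 2)^-1 z * f z).
Proof. by []. Qed.

Lemma fock_weight_gauss gamma (z : R[i]) :
  gauss (gamma%:C ^+ 2)^-1 z * (gauss (gamma%:C ^+ 2)^-1 z)^*%C *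
    fock_weight (2 / gamma ^+ 2) z = rbf_weight gamma z.
Proof.
rewrite rbf_weightE fock_weightE /gauss /cexp.
rewrite -rmorphXn -fmorphV; move: (gamma ^+ 2)^-1 => r.
case: z => x y /=.
set a := (X in expR X * _); set b := cos _; set b' := sin _.
(* [a] is the real part of z^2 / gamma^2; it occurs twice because |gauss|^2 is
   gauss times its conjugate. *)
have -> : - (4 * y ^+ 2 * r) = a + a + - (2 * r * (x ^+ 2 + y ^+ 2)).
  by rewrite /a /=; ring.
have cs : b ^+ 2 = 1 - b' ^+ 2 by apply/eqP; rewrite eq_sym subr_eq cos2Dsin2.
rewrite !expRD; move: (expR _) (expR _) => e e'.
by apply/eqP; rewrite eq_complex /=; apply/andP; split; apply/eqP; ring: cs.
Qed.

Lemma fock_wdot_mulM gamma f g :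
  wdot (2 / gamma ^+ 2 / pi) (fock_weight (2 / gamma ^+ 2))
    (mulM gamma f) (mulM gamma g) =
  wdot (2 / (gamma ^+ 2 * pi)) (rbf_weight gamma) f g.
Proof.
rewrite /wdot -mulrA -invfM; congr (_ * cintegral _).
apply/funext => z; rewrite !mulME rmorphM -fock_weight_gauss.
by move: (gauss _ _) (fock_weight _ _) (f z) (g z) => *; ring.
Qed.

(** This does not follow from [fock_wdot_mulM] with f = g: the square norms take
    values in the extended reals, and membership in the spaces is the finiteness
    of these. *)
Lemma fock_normsq_mulM gamma f :
  fock_normsq (2 / gamma ^+ 2) (mulM gamma f) = rbf_normsq gamma f.
Proof.
rewrite /fock_normsq /rbf_normsq /wnormsq -mulrA -invfM.
congr (_ * _)%E; apply: eq_integral => p _; congr (Re _)%:E.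
rewrite !mulME !sqr_normc rmorphM -fock_weight_gauss.
by move: (gauss _ _) (fock_weight _ _) (f _) => *; ring.
Qed.

Lemma mulM_fock gamma N f :
  f \in rbf_pred N gamma -> mulM gamma f \in fock_pred N (2 / gamma ^+ 2).
Proof.
move=> /asboolP[pf nf]; apply/asboolP; split; last by rewrite fock_normsq_mulM.
exact: (polyanalytic_holomorphicM (cclassC_gauss _) (dbar_gauss _) pf).
Qed.

Definition divM gamma f : R[i] -> R[i] :=
  fun z => gauss (- (gamma%:C ^+ 2)^-1) z * f z.

Lemma mulMK gamma : cancel (mulM gamma) (divM gamma).
Proof.
move=> f; apply/funext => z; rewrite mulME /divM mulrA.
by rewrite [_ * gauss _ _]mulrC gaussN mul1r.
Qed.

Lemma divMK gamma : cancel (divM gamma) (mulM gamma).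
Proof.
by move=> f; apply/funext => z; rewrite mulME /divM mulrA gaussN mul1r.
Qed.

Lemma divM_rbf gamma N f :
  f \in fock_pred N (2 / gamma ^+ 2) -> divM gamma f \in rbf_pred N gamma.
Proof.
move=> /asboolP[pf nf]; apply/asboolP; split; last first.
  by rewrite -fock_normsq_mulM divMK.
exact: (polyanalytic_holomorphicM (cclassC_gauss _) (dbar_gauss _) pf).
Qed.

Definition rbf_to_fock N gamma (f : rbf_space N gamma) :
    fock_space N (2 / gamma ^+ 2) :=
  FockSpace (mulM_fock (valP f)).

Definition fock_to_rbf N gamma (f : fock_space N (2 / gamma ^+ 2)) :
    rbf_space N gamma :=
  RbfSpace (divM_rbf (valP f)).

Lemma rbf_to_fock_linear N gamma : linear (@rbf_to_fock N gamma).
Proof.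
move=> a f g; apply: val_inj; apply/funext => z.
(* Both sides are values of functions built with the pointwise operations, so
   they unfold to the two sides of [E]. *)
have E (c u v e : R[i]) : e * (c * u + v) = c * (e * u) + e * v by ring.
exact: E.
Qed.

HB.instance Definition _ N gamma := GRing.isLinear.Build R[i]
  (rbf_space N gamma) (fock_space N (2 / gamma ^+ 2)) _
  (@rbf_to_fock N gamma) (@rbf_to_fock_linear N gamma).

Lemma rbf_to_fock_bij N gamma : bijective (@rbf_to_fock N gamma).
Proof.
exists (@fock_to_rbf N gamma) => f; apply: val_inj; first exact: mulMK.
exact: divMK.
Qed.

End Isometry.

Theorem theorem4p18 (R : realType) (gamma : R) (N : nat)
    (gamma_gt0 : 0 < gamma) (N_gt0 : (0 < N)%N) :
  exists M : {linear rbf_space N gamma -> fock_space N (2 / gamma ^+ 2)},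
    (forall f z, M f z = mulM gamma f z) /\
    unitary (@rbf_dot R N gamma) (@fock_dot R N (2 / gamma ^+ 2)) M.
Proof.
exists (@rbf_to_fock R N gamma : {linear _ -> _}); split=> //.
split; first exact: rbf_to_fock_bij.
by move=> f g; exact: fock_wdot_mulM.
Qed.
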